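(* For even $b\ge2$: $K_{2\lambda}(1)=2\lambda$ for $0\le\lambda\le\frac{b-2}{2}$, and $K_{2\lambda+1}(1)=b+2\lambda$ for $0\le\lambda\le\frac{b-4}{2}$. For odd $b\ge3$: $K_{2\lambda}(1)=2\lambda$ for $0\le\lambda\le\frac{b-3}{2}$.
   Context: Fix a base $b\ge2$. For $v\in\mathbb{N}$, $s(v)$ is the sum of the base-$b$ digits of $v$, $f(v)=v+s(v)$, and $F(u)=|\{v\in\mathbb{N}: f(v)=u\}|$. For a residue class $i$ modulo $b-1$ (with $i$ even if $b$ is odd), $K_i(n)$ is the smallest $u\in\mathbb{N}$ with $F(u)=n$ and $u\equiv i\pmod{b-1}$. Subscripts are read modulo $b-1$. *)

(* Defs.v *)
From mathcomp Require Import all_boot.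
From mathcomp Require Import finmap.
From mathcomp Require Import boolp classical_sets functions cardinality.

Set Implicit Arguments.
Unset Strict Implicit.
Unset Printing Implicit Defensive.

Local Open Scope nat_scope.
Local Open Scope classical_set_scope.

(* The i-th base-b digit of v is v %/ b ^ i %% b; for b >= 2 it vanishes as
   soon as i >= v because v < b ^ v, so the digits of index i < v suffice. *)
Definition digit_sum (b v : nat) : nat := \sum_(i < v) (v %/ b ^ i) %% b.

Definition self_gen (b v : nat) : nat := v + digit_sum b v.

Definition fiber (b u : nat) : set nat := [set v | self_gen b v = u].

(* [fset_set] sends an infinite set to [fset0]; [finite_fiber] shows that
   this default value is never used. *)
Definition gen_count (b u : nat) : nat := #|` fset_set (fiber b u)|%fset.

Lemma finite_fiber (b u : nat) : finite_set (fiber b u).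
Proof.
apply: (sub_finite_set _ (finite_II u.+1)) => v /= <-.
by rewrite ltnS leq_addr.
Qed.

(* [is_K b i n u] is the relation K_i(n) = u in base b. The subscript is any
   natural representative of a class modulo b - 1. K is a relation because
   no u need have F(u) = n in a given class (e.g. b odd, i odd, n > 0). *)
Definition is_K (b i n u : nat) : Prop :=
  [/\ gen_count b u = n,
      u = i %[mod b - 1]
    & forall w : nat, gen_count b w = n -> w = i %[mod b - 1] -> u <= w].

(* Main.v *)
Require Import Defs.
From mathcomp Require Import all_boot.
From mathcomp Require Import zify.
From mathcomp Require Import finmap.
From mathcomp Require Import classical_sets cardinality.

(** A value u < 2b is only generated by v < 2b, where v + s(v) is 2v for v < b
    and 2v - b + 1 for v >= b. For u < b this forces u = 2v, so even u have one
    generator and odd u none; for b even and u = b + 2l < 2b, parity excludes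
    v >= b and leaves v = b/2 + l. *)

Lemma digit_sum_two_digits (b v : nat) :
  2 <= b -> v < b ^ 2 -> digit_sum b v = v %% b + v %/ b.
Proof.
(* [digit_sum] has as many terms as the value of [v], so 0 and 1 give fewer than two terms and are
   treated apart. *)
move=> b2; rewrite /digit_sum; case: v => [|[|v]] lt_v.
- by rewrite big_ord0 mod0n div0n.
- by rewrite big_ord_recl big_ord0 divn1 (divn_small b2).
rewrite 2!big_ord_recl /= expn0 expn1 divn1 big1 => [|i _].
  rewrite (modn_small (m := _ %/ b)) ?addn0 //.
  by rewrite ltn_divLR ?mulnn // ltnW.
(* The remaining indices are at least 2, where [b ^ 2 <= b ^ i] makes the quotient vanish. *)
rewrite divn_small ?mod0n //; apply: (leq_trans lt_v).
by rewrite leq_exp2l.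
Qed.

Lemma self_gen_one_digit (b v : nat) : 2 <= b -> v < b -> self_gen b v = v.*2.
Proof.
move=> b2 vb; rewrite /self_gen digit_sum_two_digits //; last by nia.
by rewrite modn_small // divn_small // addn0 addnn.
Qed.

Lemma self_gen_leading_one (b v : nat) :
  2 <= b -> v < b -> self_gen b (b + v) = b + v.*2.+1.
Proof.
move=> b2 vb; rewrite /self_gen digit_sum_two_digits //; last by nia.
rewrite modnDl modn_small // divnDl ?dvdnn // divnn (ltnW b2) divn_small //.
lia.
Qed.

(** Confines the search for generators of a small value to numbers covered by the two formulas
    above. *)
Lemma self_gen_ge (b v : nat) : v <= self_gen b v.
Proof. exact: leq_addr. Qed.

Lemma gen_count_unique (b u v : nat) :
  self_gen b v = u -> (forall w, self_gen b w = u -> w = v) ->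
  gen_count b u = 1.
Proof.
move=> vu uniq_v; rewrite /gen_count.
have -> : fiber b u = [set v]%classic.
  by apply/seteqP; split=> w /= => [/uniq_v|->].
by rewrite fset_set1 cardfs1.
Qed.

Lemma gen_count_none (b u : nat) :
  (forall w, self_gen b w <> u) -> gen_count b u = 0.
Proof.
move=> no_w; rewrite /gen_count.
have -> : fiber b u = set0 by apply/seteqP; split=> w //= /no_w.
by rewrite fset_set0 cardfs0.
Qed.

Lemma gen_count_even_lt (b l : nat) : 2 <= b -> l.*2 < b ->
  gen_count b l.*2 = 1.
Proof.
move=> b2 lb; apply: (@gen_count_unique _ _ l) => [|w wl].
  by apply: self_gen_one_digit => //; lia.
have lt_wb : w < b by move: (self_gen_ge b w); lia.
rewrite self_gen_one_digit // in wl; lia.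
Qed.

Lemma gen_count_odd_lt (b l : nat) : 2 <= b -> l.*2.+1 < b ->
  gen_count b l.*2.+1 = 0.
Proof.
move=> b2 lb; apply: gen_count_none => w wl.
have lt_wb : w < b by move: (self_gen_ge b w); lia.
rewrite self_gen_one_digit // in wl; lia.
Qed.

Lemma gen_count_even_base (b l : nat) : 2 <= b -> ~~ odd b -> l.*2 < b ->
  gen_count b (b + l.*2) = 1.
Proof.
move=> b2 even_b lb; have b_half := even_halfK even_b.
apply: (@gen_count_unique _ _ (b./2 + l)) => [|w wl].
  by rewrite self_gen_one_digit //; lia.
have le_w := self_gen_ge b w.
case: (ltnP w b) => [lt_wb | le_bw].
  by rewrite self_gen_one_digit // in wl; lia.
(* As [w <= b + 2l < 2b], the leading digit of [w] is 1, and [w - b] is its last digit. *)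
have lt_w : w - b < b by lia.
rewrite -(subnKC le_bw) self_gen_leading_one // in wl; lia.
Qed.

(** Since [2l < b - 1], the number [2l] is its own residue, hence the least member of its class. *)
Lemma is_K_even (b l : nat) : 2 <= b -> 2 * l + 2 <= b ->
  is_K b (2 * l) 1 (2 * l).
Proof.
rewrite mul2n => b2 lb; split=> // [|w _ w_l].
  by apply: gen_count_even_lt => //; lia.
by rewrite -(modn_small (m := l.*2) (d := b - 1)) -?w_l ?leq_mod //; lia.
Qed.

(** The class of [2l + 1] starts with [2l + 1] itself, an odd number below [b] and so without
    generator; the next member is [(b - 1) + (2l + 1) = b + 2l]. *)
Lemma is_K_odd (b l : nat) : ~~ odd b -> 2 * l + 4 <= b ->
  is_K b (2 * l + 1) 1 (b + 2 * l).
Proof.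
rewrite mul2n addn1 => even_b lb; have b2 : 2 <= b by lia.
split=> [||w w1 w_l].
- by apply: gen_count_even_base => //; lia.
- have -> : b + l.*2 = (b - 1) + l.*2.+1 by lia.
  by rewrite modnDl.
have w_l1 : w %% (b - 1) = l.*2.+1 by rewrite w_l modn_small //; lia.
case: (ltnP w (b - 1)) => [lt_w | le_w].
  by move: w1; rewrite -(modn_small lt_w) w_l1 gen_count_odd_lt //; lia.
(* Here [w - (b - 1)] has residue [2l + 1], so it is at least [2l + 1]. *)
rewrite -(subnKC le_w) modnDl in w_l1.
have := leq_mod (w - (b - 1)) (b - 1); lia.
Qed.

Theorem theorem4p5 (b : nat) :
  (2 <= b -> ~~ odd b ->
     (forall l : nat, 2 * l + 2 <= b -> is_K b (2 * l) 1 (2 * l)) /\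
     (forall l : nat, 2 * l + 4 <= b -> is_K b (2 * l + 1) 1 (b + 2 * l))) /\
  (3 <= b -> odd b ->
     forall l : nat, 2 * l + 3 <= b -> is_K b (2 * l) 1 (2 * l)).
Proof.
split=> [b2 even_b | b3 _ l lb]; last by apply: is_K_even; lia.
split=> l lb; first exact: is_K_even.
exact: is_K_odd.
Qed.
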